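(* Let $k,l\in\mathbb{N}$ be such that $l<k$ and let $A$ be a bounded operator on a complex Hilbert space $\mathcal{H}$ (not assumed separable). Then the following conditions are equivalent: (i) $A$ is quasinormal; (ii) $(A^* )^sA^s=(A^*A)^s$ for all $s\in\{l,\,l+1,\,k,\,k+1\}$.
   Context: $\mathbb{N}$ denotes the set of positive integers. A bounded operator $A$ on a complex Hilbert space is called quasinormal if $A(A^*A)=(A^*A)A$. *)

(* Defs.v *)
From HB Require Import structures.
From mathcomp Require Import all_boot all_order all_algebra.
From mathcomp Require Import sesquilinear complex.
From mathcomp Require Import all_classical all_reals all_analysis.

Set Implicit Arguments.
Unset Strict Implicit.
Unset Printing Implicit Defensive.

Import Order.TTheory GRing.Theory Num.Theory.
Import numFieldNormedType.Exports.

Local Open Scope classical_set_scope.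
Local Open Scope ring_scope.
Local Open Scope complex_scope.

(* The inner product of a complex Hilbert space is linear in its first argument
   and conjugate-linear in its second one (the convention of {dot _ for _}). *)
HB.mixin Record CompleteNormedModule_isHilbert (R : realType) H
    of CompleteNormedModule R[i] H := {
  inner : {dot H for (@Num.conj R[i])} ;
  inner_norm : forall x : H, inner x x = `|x| ^+ 2
}.

#[short(type="hilbertType")]
HB.structure Definition Hilbert (R : realType) :=
  {H of CompleteNormedModule R[i] H & CompleteNormedModule_isHilbert R H}.

Section Operators.
Context {R : realType} {H : hilbertType R}.
Implicit Types (A : {linear H -> H}) (B : H -> H).

Definition bounded_operator A :=
  exists M : R, forall x : H, `|A x| <= M%:C * `|x|.

(* For bounded A, the Riesz representation theorem provides for each y exactly
   one z as below, so that the default value 0 of xget is never used. *)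
Definition adjoint A : H -> H := fun y : H =>
  xget 0 [set z : H | forall x : H, inner (A x) y = inner x z].

Definition quasinormal A :=
  A \o (adjoint A \o A) = (adjoint A \o A) \o A.

End Operators.

(* Main.v *)
From HB Require Import structures.
Require Import Defs.
From mathcomp Require Import all_boot all_order all_algebra.
From mathcomp Require Import all_reals.
From mathcomp Require Import sesquilinear complex ring lra zify.
From mathcomp Require Import all_classical all_analysis.

(* Put T = A^* A. The equalities for l, l + 1 and k, k + 1 give A^* T^l A = T^(l+1)
   and A^* T^k A = T^(k+1), so that A^* f(T) A = T f(T) for every f in the span of
   1, t^l and t^k. For a >= 0 this span contains
     f(t) = l t^k - k a^(k-l) t^l + (k-l) a^k = (t - a)^2 q(t)
   where q has nonnegative coefficients, hence a^k |(T - a) A x|^2 <= C |(T - a) x|^2.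
   This bounds the defect D = T A - A T, and since T^k - a^k is a multiple of T - a the
   factor a^k can be traded for T^k: |D T^k x| <= C' |(T - a) x| uniformly in a. So, by
   the next remark, T^k D^* = 0, from which T D^* = 0, A D^* = 0 and finally D = 0.

   A vector z with |<x, z>| <= C |(T - a) x| for all x and all a in [0, |T|] vanishes:
   its spectral measure gives mass O(r^2) to intervals of length r. Spectral projections
   are replaced by Bernstein polynomials in T, whose positivity comes from that of T
   and 1 - T (after normalising T <= 1). All this only involves the real part of the
   inner product; the adjoint is obtained from the Riesz representation theorem. *)

Set Implicit Arguments.
Unset Strict Implicit.
Unset Printing Implicit Defensive.

Import Order.TTheory GRing.Theory Num.Theory.
Import numFieldNormedType.Exports.

Local Open Scope ring_scope.

(** * Bernstein polynomials and a cone of polynomials *)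

Section BernsteinOperator.
Context {R : comNzRingType}.
Implicit Types (F G : nat -> {poly R}) (n j : nat).

(* The sum over j <= n of F j * 'C(n, j) * 'X^j * (1 - 'X)^(n - j). *)
Fixpoint bernstein n F : {poly R} :=
  if n is m.+1 then (1 - 'X) * bernstein m F + 'X * bernstein m (F \o S)
  else F 0%N.

Lemma eq_bernstein n F G :
  (forall j, (j <= n)%N -> F j = G j) -> bernstein n F = bernstein n G.
Proof.
elim: n F G => [|n IH] F G FG /=; first exact: FG.
by congr (_ * _ + _ * _); apply: IH => j jn; apply: FG => //; apply: leqW.
Qed.

Lemma bernsteinD n F G :
  bernstein n (fun j => F j + G j) = bernstein n F + bernstein n G.
Proof.
elim: n F G => //= n IH F G; rewrite IH [bernstein n (_ \o _)]IH.
by rewrite !mulrDr addrACA.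
Qed.

Lemma bernsteinM n p F : bernstein n (fun j => p * F j) = p * bernstein n F.
Proof.
elim: n F => //= n IH F; rewrite IH [bernstein n (_ \o _)]IH.
by rewrite mulrDr !(mulrCA p).
Qed.

Lemma bernstein_cst n p : bernstein n (fun=> p) = p.
Proof. by elim: n => //= n IH; rewrite IH -mulrDl subrK mul1r. Qed.

Lemma bernsteinB n F G :
  bernstein n (fun j => F j - G j) = bernstein n F - bernstein n G.
Proof.
rewrite bernsteinD; congr (_ + _); rewrite -[RHS]mulN1r -bernsteinM.
by apply: eq_bernstein => j _; rewrite mulN1r.
Qed.

Lemma bernstein_sum n (I : Type) (r : seq I) (F : I -> nat -> {poly R}) :
  bernstein n (fun j => \sum_(i <- r) F i j) = \sum_(i <- r) bernstein n (F i).
Proof.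
elim: r => [|i r IH].
  rewrite big_nil -[RHS](bernstein_cst n).
  by apply: eq_bernstein => j _; rewrite big_nil.
by rewrite big_cons -IH -bernsteinD; apply: eq_bernstein => j _; rewrite big_cons.
Qed.

(** [bernstein n F] is the expectation of [F j] for j binomial with parameters n and ['X]. Here and
    below, its first two moments are computed by recursion on the number of trials. *)
Lemma bernstein_mean n : bernstein n (fun j => j%:R) = n%:R * 'X.
Proof.
elim: n => /= [|n IH]; first by rewrite mul0r.
rewrite IH (@eq_bernstein n _ (fun j => j%:R + 1)) => [|j _].
  by rewrite bernsteinD bernstein_cst IH -natr1; ring.
by rewrite /= -natr1.
Qed.

Lemma bernstein_moment2 n :
  bernstein n (fun j => j%:R ^+ 2) = n%:R * 'X * (1 - 'X) + (n%:R * 'X) ^+ 2.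
Proof.
elim: n => /= [|n IH]; first by rewrite !mul0r add0r.
rewrite IH (@eq_bernstein n _ (fun j => j%:R ^+ 2 + (2 * j%:R + 1))) => [|j _].
  by rewrite !bernsteinD bernstein_cst bernsteinM bernstein_mean IH -natr1; ring.
by rewrite /= -natr1; ring.
Qed.

Lemma bernstein_variance n :
  bernstein n (fun j => (n%:R * 'X - j%:R) ^+ 2) = n%:R * 'X * (1 - 'X).
Proof.
rewrite (@eq_bernstein n _ (fun j => (n%:R * 'X) ^+ 2
   + ((- (2 * n%:R * 'X)) * j%:R + j%:R ^+ 2))) => [|j _]; last by ring.
by rewrite !bernsteinD bernstein_cst bernsteinM bernstein_mean bernstein_moment2; ring.
Qed.

End BernsteinOperator.

(** * Polynomials with a certificate of nonnegativity on [0, 1] *)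

Section Cone.
Context {R : rcfType}.
Implicit Types p q : {poly R}.

(** Only closure rules that survive the substitution of an operator S with 0 <= S <= 1 are allowed,
    so membership is an algebraic substitute for nonnegativity on the spectrum of S. *)
Inductive cone : {poly R} -> Prop :=
| cone_sqr q : cone (q ^+ 2)
| coneD p q : cone p -> cone q -> cone (p + q)
| cone_mulX p : cone p -> cone ('X * p)
| cone_mul1X p : cone p -> cone ((1 - 'X) * p).

Lemma coneM p q : cone p -> cone q -> cone (p * q).
Proof.
move=> cp cq; elim: cp => {p} [r|p p' _ IH _ IH'|p _ IH|p _ IH].
- elim: cq => {q} [q|q q' _ IH _ IH'|q _ IH|q _ IH].
  + by rewrite -exprMn; apply: cone_sqr.
  + by rewrite mulrDr; apply: coneD.
  + by rewrite mulrCA; apply: cone_mulX.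
  + by rewrite mulrCA; apply: cone_mul1X.
- by rewrite mulrDl; apply: coneD.
- by rewrite -mulrA; apply: cone_mulX.
- by rewrite -mulrA; apply: cone_mul1X.
Qed.

Lemma coneC c : 0 <= c -> cone c%:P.
Proof. by move=> c0; rewrite -(sqr_sqrtr c0) rmorphXn; apply: cone_sqr. Qed.

Lemma cone0 : cone 0. Proof. exact: coneC. Qed.

Lemma cone1 : cone 1. Proof. exact: coneC. Qed.

Lemma cone1X : cone (1 - 'X).
Proof. by rewrite -[_ - _]mulr1; apply/cone_mul1X/cone1. Qed.

Lemma cone_sum (I : Type) (r : seq I) (P : pred I) (F : I -> {poly R}) :
  (forall i, P i -> cone (F i)) -> cone (\sum_(i <- r | P i) F i).
Proof. by move=> cF; elim/big_ind: _ => //; [exact: cone0 | exact: coneD]. Qed.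

Lemma coneXn n : cone 'X^n.
Proof. by elim: n => [|n IH]; [exact: cone1 | rewrite exprS; apply: cone_mulX]. Qed.

Lemma cone1Xn n : cone (1 - 'X^n).
Proof.
rewrite -(expr1n _ n) subrXX; apply: cone_mul1X; apply: cone_sum => i _.
by rewrite expr1n mul1r; apply: coneXn.
Qed.

Lemma cone_bernstein n (F : nat -> {poly R}) :
  (forall j, (j <= n)%N -> cone (F j)) -> cone (bernstein n F).
Proof.
elim: n F => [|n IH] F cF /=; first exact: cF.
apply: coneD; [apply: cone_mul1X|apply: cone_mulX];
  by apply: IH => j jn; apply: cF => //; apply: leqW.
Qed.

(** With m = [M.+1] and m ^ 2 trials, the binomial spread and the rounding of j down to a multiple
    of m are both of order m; each contributes 2 m ^ 2 to the bound. *)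
Lemma cone_bernstein_grid M :
  cone ((4 * M.+1%:R ^+ 2)%:P
    - bernstein (M.+1 * M.+1)
        (fun j => ((M.+1 ^ 2)%:R * 'X - (M.+1 * (j %/ M.+1))%:R) ^+ 2) : {poly R}).
Proof.
set m := M.+1; set n := (m * m)%N.
(* Writing j = m (j %/ m) + r, twice the variance bounds the second moment about
   m (j %/ m) up to 2 r ^+ 2, as 2 u ^+ 2 + 2 r ^+ 2 - (u + r) ^+ 2 = (u - r) ^+ 2. *)
have -> : (4 * m%:R ^+ 2)%:P
    - bernstein n (fun j => ((m ^ 2)%:R * 'X - (m * (j %/ m))%:R) ^+ 2)
  = bernstein n (fun j => (n%:R * 'X - (j + j %% m)%:R) ^+ 2
      + (2 * (m%:R ^+ 2 - (j %% m)%:R ^+ 2))%:P)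
    + (2 * m%:R ^+ 2)%:P * ((1 - 'X) + 'X ^+ 2) :> {poly R}.
  rewrite -[(4 * _)%:P](bernstein_cst n) -bernsteinB.
  have -> : (2 * m%:R ^+ 2)%:P * ((1 - 'X) + 'X ^+ 2) = (2 * m%:R ^+ 2)%:P
      - 2 * bernstein n (fun j => (n%:R * 'X - j%:R) ^+ 2) :> {poly R}.
    by rewrite bernstein_variance /n natrM polyCM polyC_exp !polyC_natr; ring.
  rewrite -[(2 * m%:R ^+ 2)%:P](bernstein_cst n) -bernsteinM -bernsteinB -bernsteinD.
  apply: eq_bernstein => j _; rewrite -mulnn -/n natrD.
  have -> : j%:R = (m * (j %/ m))%:R + (j %% m)%:R :> {poly R}.
    by rewrite -natrD {1}(divn_eq j m) mulnC.
  by rewrite !polyCM polyCB !polyC_exp !polyC_natr; ring.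
apply: coneD.
  apply: cone_bernstein => j _; apply: coneD; first exact: cone_sqr.
  apply: coneC; rewrite mulr_ge0 // subr_ge0 lerXn2r ?nnegrE ?ler0n // ler_nat.
  by rewrite ltnW // ltn_mod.
apply: coneM; first by apply: coneC; rewrite mulr_ge0 // exprn_ge0.
by apply: coneD; [exact: cone1X | exact: cone_sqr].
Qed.

End Cone.

(** * Polynomials with nonnegative coefficients and the tangent factorisation *)

Section NonnegativeCoefficients.
Context {R : rcfType}.
Implicit Types p q : {poly R}.

Definition nneg_coef p := forall i, 0 <= p`_i.

Lemma nneg_coef_sum (I : Type) (r : seq I) (F : I -> {poly R}) :
  (forall i, nneg_coef (F i)) -> nneg_coef (\sum_(i <- r) F i).
Proof. by move=> F0 j; rewrite coef_sum sumr_ge0 // => i _; apply: F0. Qed.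

Lemma nneg_coefM p q : nneg_coef p -> nneg_coef q -> nneg_coef (p * q).
Proof. by move=> p0 q0 i; rewrite coefM sumr_ge0 // => j _; rewrite mulr_ge0. Qed.

Lemma nneg_coefXn n : nneg_coef 'X^n.
Proof. by move=> i; rewrite coefXn ler0n. Qed.

Lemma nneg_coefCX c n : 0 <= c -> nneg_coef (c%:P ^+ n).
Proof. by move=> c0 [|i]; rewrite -polyC_exp coefC //= exprn_ge0. Qed.

Lemma cone_nneg p : nneg_coef p -> cone p.
Proof.
move=> p0; rewrite -[p]coefK poly_def; apply: cone_sum => i _.
by rewrite -mul_polyC; apply: coneM; [exact: coneC | exact: coneXn].
Qed.

Lemma cone_sub_horner0 p : nneg_coef p -> cone (p - p.[0]%:P).
Proof.
move=> p0; apply: cone_nneg => -[|i]; rewrite horner_coef0 coefB coefC /=.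
  by rewrite subrr.
by rewrite subr0.
Qed.

Lemma cone_horner1_sub p : nneg_coef p -> cone (p.[1]%:P - p).
Proof.
move=> p0; have -> : p.[1]%:P - p = \sum_(i < size p) (p`_i)%:P * (1 - 'X^i).
  rewrite horner_coef rmorph_sum -[X in _ - X]coefK poly_def -sumrB /=.
  by apply: eq_bigr => i _; rewrite expr1n mulr1 mulrBr mulr1 mul_polyC.
by apply: cone_sum => i _; apply: coneM; [exact: coneC | exact: cone1Xn].
Qed.

Lemma horner1_geom_le n (a : R) : 0 <= a <= 1 ->
  (\sum_(i < n) 'X^(n.-1 - i) * a%:P ^+ i).[1] <= n%:R.
Proof.
move=> /andP[a0 a1]; rewrite horner_sum -[n in n%:R]card_ord -sumr_const.
apply: ler_sum => i _.
by rewrite hornerM -polyC_exp hornerC hornerXn expr1n mul1r exprn_ile1.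
Qed.

Lemma nneg_geom n (a : R) : 0 <= a ->
  nneg_coef (\sum_(i < n) 'X^(n.-1 - i) * a%:P ^+ i).
Proof.
move=> a0; apply: nneg_coef_sum => i.
by apply: nneg_coefM; [exact: nneg_coefXn | exact: nneg_coefCX].
Qed.

(* Up to the factor l, the left-hand side is the gap at u = t ^ l between the convex
   function u ^ ((l + d) / l) and its tangent at u = a ^ l. *)
Lemma tangent_factor l d (a : R) : 0 <= a <= 1 ->
  exists q : {poly R}, [/\ l%:R * 'X^(l + d) - (l + d)%:R * a%:P ^+ d * 'X^l
      + d%:R * a%:P ^+ (l + d) = ('X - a%:P) ^+ 2 * q,
    nneg_coef q & q.[1] <= (d * l * (l + d))%:R].
Proof.
move=> a01; have /andP[a0 a1] := a01.
pose geom n := \sum_(m < n) 'X^(n.-1 - m) * a%:P ^+ m.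
have geomE n : 'X^n - a%:P ^+ n = ('X - a%:P) * geom n by exact: subrXX.
(* One division by ['X - a] leaves l X^l (geom d) - d a^d (geom l). Spread over the d l pairs (i,
   j), this is a sum of terms X^(l-1-j) a^i (X^(d+j-i) - a^(d+j-i)), each divisible by ['X - a] once
   more. *)
exists (\sum_(i < d) \sum_(j < l) 'X^(l.-1 - j) * a%:P ^+ i * geom (d + j - i)%N).
split.
- rewrite expr2 -[RHS]mulrA.
  have -> : ('X - a%:P)
      * (\sum_(i < d) \sum_(j < l) 'X^(l.-1 - j) * a%:P ^+ i * geom (d + j - i)%N)
    = 'X^l * (l%:R * geom d) - a%:P ^+ d * (d%:R * geom l).
    rewrite mulr_sumr.
    transitivity (\sum_(i < d) \sum_(j < l)
       ('X^l * ('X^(d.-1 - i) * a%:P ^+ i) - a%:P ^+ d * ('X^(l.-1 - j) * a%:P ^+ j))).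
      apply: eq_bigr => i _; rewrite mulr_sumr; apply: eq_bigr => j _.
      rewrite mulrCA -geomE mulrBr mulrAC -exprD -mulrA -exprD.
      have /= ltid := ltn_ord i; have /= ltjl := ltn_ord j.
      have -> : (l.-1 - j + (d + j - i) = l + (d.-1 - i))%N by lia.
      have -> : (i + (d + j - i) = d + j)%N by lia.
      by rewrite !exprD; ring.
    under eq_bigr do rewrite sumrB sumr_const card_ord -mulr_sumr -/(geom l).
    rewrite sumrB sumr_const card_ord sumrMnl -mulr_sumr -/(geom d).
    by rewrite !mulr_natl !mulrnAr.
  rewrite mulrBr !(mulrCA ('X - _)) -!geomE !exprD natrD; ring.
- apply: nneg_coef_sum => i; apply: nneg_coef_sum => j.
  apply: nneg_coefM; last exact: nneg_geom.
  by apply: nneg_coefM; [exact: nneg_coefXn | exact: nneg_coefCX].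
(* There are d l terms, and at 1 each is at most d + j - i <= l + d. *)
- rewrite horner_sum -mulnA natrM -[d in d%:R]card_ord mulr_natl -sumr_const.
  apply: ler_sum => i _.
  rewrite horner_sum natrM -[l in l%:R]card_ord mulr_natl -sumr_const.
  apply: ler_sum => j _.
  rewrite !hornerM -polyC_exp hornerC hornerXn expr1n mul1r.
  have g_le := horner1_geom_le (d + j - i) a01.
  have g_ge0 : 0 <= (geom (d + j - i)%N).[1].
    rewrite horner_coef; apply: sumr_ge0 => m _; rewrite expr1n mulr1.
    exact: nneg_geom.
  apply: le_trans (_ : (geom (d + j - i)%N).[1] <= _).
    by rewrite ler_piMl // exprn_ile1.
  by apply: le_trans g_le _; rewrite ler_nat; have := ltn_ord j; lia.
Qed.

End NonnegativeCoefficients.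

Lemma sqr_sum_le (R : realFieldType) n (u : 'I_n -> R) :
  (\sum_i u i) ^+ 2 <= n%:R * \sum_i u i ^+ 2.
Proof.
case: n u => [|n] u; first by rewrite big_ord0 expr0n mul0r.
set s := \sum_i u i; set t := \sum_i _; set r := n.+1%:R.
have : 0 <= \sum_i (r * u i - s) ^+ 2 by apply: sumr_ge0 => i _; apply: sqr_ge0.
have -> : \sum_i (r * u i - s) ^+ 2 = r * (r * t - s ^+ 2).
  under eq_bigr do rewrite sqrrB exprMn.
  rewrite big_split /= sumrB -mulr_sumr sumr_const card_ord -/t.
  rewrite sumrMnl -mulr_suml -mulr_sumr -/s -mulr_natl -/r; ring.
by rewrite pmulr_rge0 ?subr_ge0 // ltr0n.
Qed.

(** * Polynomials in a positive contraction *)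

Section PolyAction.
Context {R : comNzRingType} {V : lmodType R} (S : {linear V -> V}).
Implicit Types (p q : {poly R}) (x y : V).

(** This is p(S) x: [V] becomes a module over [{poly R}] on which ['X] acts as [S]. *)
Definition pact p x := \sum_(i < size p) p`_i *: iter i S x.

Lemma pact_wide n p x :
  (size p <= n)%N -> pact p x = \sum_(i < n) p`_i *: iter i S x.
Proof.
move=> pn; rewrite /pact (big_ord_widen n (fun i => p`_i *: iter i S x) pn).
rewrite [RHS](bigID (fun i : 'I_n => (i < size p)%N)) /= [X in _ + X]big1 ?addr0 //.
by move=> i; rewrite -leqNgt => pi; rewrite nth_default // scale0r.
Qed.

Lemma pactD p q x : pact (p + q) x = pact p x + pact q x.
Proof.
rewrite !(@pact_wide (maxn (size p) (size q))) ?leq_maxl ?leq_maxr ?size_polyD //.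
by rewrite -big_split /=; apply: eq_bigr => i _; rewrite coefD scalerDl.
Qed.

Lemma pactZ c p x : pact (c *: p) x = c *: pact p x.
Proof.
rewrite !(@pact_wide (size p)) ?size_scale_leq // scaler_sumr.
by apply: eq_bigr => i _; rewrite coefZ scalerA.
Qed.

Lemma pact_is_linear p : linear (pact p).
Proof.
move=> c x y; rewrite /pact scaler_sumr -big_split /=; apply: eq_bigr => i _.
rewrite scalerA [c * _]mulrC -scalerA -scalerDr; congr (_ *: _).
by elim: (nat_of_ord i) => //= j ->; rewrite linearP.
Qed.

HB.instance Definition _ p := GRing.isLinear.Build R V V _ (pact p) (pact_is_linear p).

Lemma pactC c x : pact c%:P x = c *: x.
Proof. by rewrite (@pact_wide 1%N) ?size_polyC_leq1 // big_ord1 coefC. Qed.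

Lemma pact1 x : pact 1 x = x. Proof. by rewrite pactC scale1r. Qed.

Lemma pactMX p x : pact (p * 'X) x = pact p (S x).
Proof.
rewrite (@pact_wide (size p).+1) ?size_polyMleq //; last first.
  by rewrite (leq_trans (size_polyMleq _ _)) // size_polyX addn2.
rewrite big_ord_recl coefMX eqxx scale0r add0r /pact.
by apply: eq_bigr => i _; rewrite coefMX /= -iterSr.
Qed.

Lemma pactM p q x : pact (p * q) x = pact p (pact q x).
Proof.
elim/poly_ind: q x => [|q c IH] x.
  by rewrite mulr0 pactC scale0r linear0.
rewrite mulrDr pactD mulrA pactMX IH pactD pactMX linearD /= pactC linearZ /=.
by rewrite [p * _]mulrC mul_polyC pactZ.
Qed.

Lemma pactX x : pact 'X x = S x.
Proof. by rewrite -['X]mul1r pactMX pact1. Qed.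

Lemma pactXn n x : pact 'X^n x = iter n S x.
Proof.
elim: n x => [|n IH] x; first exact: pact1.
by rewrite exprS pactM pactX IH.
Qed.

Lemma pactB p q x : pact (p - q) x = pact p x - pact q x.
Proof. by rewrite pactD -[- q]scaleN1r pactZ scaleN1r. Qed.

Lemma pactXC c x : pact ('X - c%:P) x = S x - c *: x.
Proof. by rewrite pactB pactX pactC. Qed.

Lemma pact_sum (I : Type) (r : seq I) (F : I -> {poly R}) x :
  pact (\sum_(i <- r) F i) x = \sum_(i <- r) pact (F i) x.
Proof.
elim: r => [|i r IH]; first by rewrite !big_nil pactC scale0r.
by rewrite !big_cons pactD IH.
Qed.

End PolyAction.

(** * Real inner products *)

Section RealForm.
Context {R : realFieldType} {V : lmodType R} (B : {dot V for idfun}).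
Local Notation "''[' u , v ]" := (B u v) : ring_scope.
Local Notation "''[' u ]" := (B u u) : ring_scope.
Implicit Types x y z : V.

Lemma formC x y : '[x, y] = '[y, x].
Proof. by rewrite hermC expr0 mul1r. Qed.

Lemma formZl c x y : '[c *: x, y] = c * '[x, y].
Proof. exact: linearZl_LR. Qed.

Lemma formZr c x y : '[x, c *: y] = c * '[x, y].
Proof. by rewrite formC formZl formC. Qed.

Lemma form_gt0 x : x != 0 -> 0 < '[x].
Proof. exact: neq0_dnorm_gt0. Qed.

Lemma form_ge0 x : 0 <= '[x].
Proof.
by have [->|/form_gt0/ltW //] := eqVneq x 0; rewrite linear0l.
Qed.

Lemma form_eq0 x : '[x] = 0 -> x = 0.
Proof. by move=> x0; apply/eqP/negPn/negP => /form_gt0; rewrite x0 ltxx. Qed.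

Lemma form_normD x y : '[x + y] = '[x] + 2 * '[x, y] + '[y].
Proof. by rewrite linearDl !linearDr /= (formC y x); ring. Qed.

Lemma form_normB x y : '[x - y] = '[x] - 2 * '[x, y] + '[y].
Proof. by rewrite form_normD linearNr /= hnormN mulrN. Qed.

Lemma form_normD_le x y : '[x + y] <= 2 * '[x] + 2 * '[y].
Proof.
by have := form_ge0 (x - y); rewrite form_normB form_normD; lra.
Qed.

Lemma form_CauchySchwarz x y : '[x, y] ^+ 2 <= '[x] * '[y].
Proof.
have [->|y0] := eqVneq y 0; first by rewrite !linear0r expr0n.
have := form_ge0 ('[y] *: x - '[x, y] *: y).
rewrite linearBl !linearBr /= !formZl !formZr (formC y x).
have := form_gt0 y0; move: '[y] '[x] '[x, y] => b a c b0 h.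
suff : 0 <= b * (a * b - c ^+ 2) by rewrite pmulr_rge0 // subr_ge0.
by apply: le_trans h _; rewrite le_eqVlt; apply/orP; left; apply/eqP; ring.
Qed.

Lemma form_ext x y : (forall z, '[z, x] = '[z, y]) -> x = y.
Proof.
move=> xy; apply/eqP; rewrite -subr_eq0; apply/eqP/form_eq0.
by rewrite linearBr /= xy subrr.
Qed.

End RealForm.

(** * Positivity of polynomials in a symmetric operator between 0 and 1 *)

Section PositiveContraction.
Context {R : realType} {V : lmodType R} (B : {dot V for idfun}).
Local Notation "''[' u , v ]" := (B u v) : ring_scope.
Local Notation "''[' u ]" := (B u u) : ring_scope.
Variable S : {linear V -> V}.
Hypothesis S_sym : forall x y, '[S x, y] = '[x, S y].
Hypothesis S_ge0 : forall x, 0 <= '[S x, x].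
Hypothesis S_le1 : forall x, '[S x, x] <= '[x].
Implicit Types (p q : {poly R}) (x y z : V).

Lemma pact_sym p x y : '[pact S p x, y] = '[x, pact S p y].
Proof.
elim/poly_ind: p x y => [|p c IH] x y.
  by rewrite !pactC !scale0r linear0l linear0r.
rewrite !pactD linearDl linearDr /= !pactC formZl formZr; congr (_ + _).
by rewrite pactMX [p * 'X]mulrC pactM pactX IH S_sym.
Qed.

Lemma form_pactM p q x : '[pact S (p ^+ 2 * q) x, x] = '[pact S q (pact S p x), pact S p x].
Proof. by rewrite expr2 mulrAC -mulrA pactM pact_sym pactM. Qed.

(** The induction carries p, X p, (1 - X) p and X (1 - X) p together: multiplying by X or 1 - X
    permutes these four up to square factors, which symmetry absorbs. The product X (1 - X) itself
    is positive because it equals (1 - X)^2 X + X^2 (1 - X), so no square root of an operator is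
    taken. *)
Lemma cone_pact_ge0 p x : cone p -> 0 <= '[pact S p x, x].
Proof.
pose pos p := forall x, 0 <= '[pact S p x, x].
have posD p1 p2 : pos p1 -> pos p2 -> pos (p1 + p2).
  by move=> h1 h2 y; rewrite pactD linearDl addr_ge0 ?h1 ?h2.
have posM q p1 : pos p1 -> pos (q ^+ 2 * p1).
  by move=> h1 y; rewrite form_pactM h1.
have pos1 : pos 1 by move=> y; rewrite pact1 form_ge0.
have posX : pos 'X by move=> y; rewrite pactX S_ge0.
have pos1X : pos (1 - 'X).
  by move=> y; rewrite pactB pact1 pactX linearBl subr_ge0 S_le1.
have posX1X : pos ('X * (1 - 'X)).
  have -> : 'X * (1 - 'X) = (1 - 'X) ^+ 2 * 'X + 'X ^+ 2 * (1 - 'X) :> {poly R} by ring.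
  by apply: posD; apply: posM.
move=> cp; suff [h _ _ _] : [/\ pos p, pos ('X * p), pos ((1 - 'X) * p)
  & pos ('X * (1 - 'X) * p)] by exact: h.
elim: cp => {p x} [q|p q _ [p1 p2 p3 p4] _ [q1 q2 q3 q4]|p _ [p1 p2 p3 p4]|p _ [p1 p2 p3 p4]].
- have sq p : pos p -> pos (p * q ^+ 2) by rewrite mulrC; apply: posM.
  by split; [rewrite -[q ^+ 2]mul1r|..]; apply: sq.
- by split; [|rewrite mulrDr|rewrite mulrDr|rewrite (mulrDr _ p q)]; apply: posD.
- split; [exact: p2| | |].
  + by rewrite mulrA -expr2; apply: posM.
  + by rewrite mulrA [_ * 'X]mulrC.
  + have -> : 'X * (1 - 'X) * ('X * p) = 'X ^+ 2 * ((1 - 'X) * p) by ring.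
    exact: posM.
- split; [exact: p3| | |].
  + by rewrite mulrA.
  + by rewrite mulrA -expr2; apply: posM.
  + have -> : 'X * (1 - 'X) * ((1 - 'X) * p) = (1 - 'X) ^+ 2 * ('X * p) by ring.
    exact: posM.
Qed.

Lemma eq0_of_resolvent_bound K z : 0 <= K ->
  (forall a x, 0 <= a <= 1 -> '[x, z] ^+ 2 <= K * '[S x - a *: x]) -> z = 0.
Proof.
move=> K0 hz; pose L p := '[pact S p z, z].
have L_ge0 p : cone p -> 0 <= L p by apply: cone_pact_ge0.
have LB p q : L (p - q) = L p - L q by rewrite /L pactB linearBl.
have L_sum m (F : 'I_m -> {poly R}) : L (\sum_i F i) = \sum_i L (F i).
  by rewrite /L pact_sum linear_sumlz.
have LC c p : L (c%:P * p) = c * L p by rewrite /L pactM pactC formZl.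
have L1 : L 1 = '[z] by rewrite /L pact1.
(* Cut [0, 1] into m intervals, with approximate indicators g a: each has mass
   at most K times the second moment of g a about its left end, and these moments
   add up to O(1 / m ^ 2). *)
have step M : '[z] * M.+1%:R <= 8 * K.
  set m := M.+1; set n := (m * m)%N.
  pose g a : {poly R} := bernstein n (fun j => (j %/ m == a)%N%:R).
  have cone_b (b : bool) : cone (b%:R : {poly R}) by case: b; [exact: cone1 | exact: cone0].
  have cone_g a : cone (g a) by apply: cone_bernstein.
  have cone_1g a : cone (1 - g a).
    rewrite -[1](bernstein_cst n) -bernsteinB; apply: cone_bernstein => j _.
    by case: eqP => _; rewrite ?subrr ?subr0; [exact: cone0 | exact: cone1].
  (* The index a runs up to m included, since j = n = m * m gives j %/ m = m. *)
  have sum_delta (f : nat -> {poly R}) j : (j <= n)%N ->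
      \sum_(a < m.+1) f a * (j %/ m == a)%N%:R = f (j %/ m)%N.
    move=> jn; have jm : (j %/ m < m.+1)%N by rewrite ltnS -[leqRHS](@mulnK m m) // leq_div2r.
    rewrite (bigD1 (Ordinal jm)) //= eqxx mulr1 big1 ?addr0 // => a.
    by rewrite -val_eqE /= eq_sym => /negbTE ->; rewrite mulr0.
  have sum_g (f : nat -> {poly R}) :
      \sum_(a < m.+1) f a * g a = bernstein n (fun j => f (j %/ m)%N).
    under eq_bigr do rewrite -bernsteinM.
    by rewrite -bernstein_sum; apply: eq_bernstein => j jn; rewrite sum_delta.
  (* The hypothesis is applied at the point a / m to the vector g_a(S) z, whose product with z is
     [L (g a)]; then 0 <= g_a <= 1 replaces g_a ^ 2 by g_a. The powers of m clear the denominator of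
     a / m. *)
  have L_g (a : 'I_m.+1) : (m%:R ^+ 2 * L (g a)) ^+ 2
      <= K * L (((m ^ 2)%:R * 'X - (m * a)%:R) ^+ 2 * g a).
    have m0 : m%:R != 0 :> R by rewrite pnatr_eq0.
    rewrite exprMn; have := hz (a%:R / m%:R) (pact S (g a) z).
    rewrite divr_ge0 ?ler0n // ler_pdivrMr ?ltr0n // mul1r ler_nat -ltnS ltn_ord.
    move=> /(_ isT); rewrite -pactXC -/(L (g a)) => /(ler_wpM2l (sqr_ge0 (m%:R ^+ 2))).
    move=> /le_trans; apply; rewrite mulrCA; apply: ler_wpM2l => //.
    rewrite -pactM pact_sym // -pactM -pact_sym // -/(L _) -LC -subr_ge0 -LB.
    apply: L_ge0; set f := 'X - _; set h := (m ^ 2)%:R * 'X - _.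
    have -> : h = (m%:R ^+ 2)%:P * f.
      have E : m%:R ^+ 2 * (a%:R / m%:R) = (m * a)%:R :> R by rewrite natrM; field.
      by rewrite /h /f mulrBr -polyCM E polyC_exp !polyC_natr natrX.
    rewrite !polyC_exp; set c := _%:P ^+ 2.
    have -> : (c * f) ^+ 2 * g a - c ^+ 2 * (f * g a * (f * g a))
      = (c * f) ^+ 2 * (g a * (1 - g a)) by ring.
    by apply: coneM; [exact: cone_sqr | exact: coneM].
  have := L_ge0 _ (cone_bernstein_grid M); rewrite LB.
  have /= <- := sum_g (fun a => ((m ^ 2)%:R * 'X - (m * a)%:R) ^+ 2); rewrite L_sum.
  rewrite -[_%:P]mulr1 LC L1 subr_ge0 -/m => /(ler_wpM2l K0).
  rewrite mulr_sumr => /(le_trans (ler_sum _ (fun a _ => L_g a))) le1.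
  (* Cauchy-Schwarz over the m + 1 cells gives (m^2 |z|^2)^2 <= 4 K m^2 (m + 1) |z|^2, and m + 1 <=
     2 m turns this into the constant 8 K. *)
  have := le_trans (sqr_sum_le _) (ler_wpM2l (ler0n _ m.+1) le1).
  rewrite -mulr_sumr -L_sum.
  have -> : \sum_(a < m.+1) g a = 1.
    rewrite -[RHS](bernstein_cst n) -(sum_g (fun=> 1)).
    by apply: eq_bigr => a _; rewrite mul1r.
  rewrite L1.
  have [->|z0] := eqVneq z 0; first by rewrite linear0l mul0r mulr_ge0.
  have := form_gt0 B z0; have : 1 <= m%:R :> R by rewrite ler1n.
  rewrite -natr1; move: m%:R '[z] => r l r1 l0 h.
  have r2l : 0 < r ^+ 3 * l by rewrite mulr_gt0 // exprn_gt0 //; lra.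
  rewrite -(ler_pM2l r2l); apply: le_trans (_ : (r + 1) * (K * (4 * r ^+ 2 * l)) <= _).
    by apply: le_trans h; rewrite le_eqVlt; apply/orP; left; apply/eqP; ring.
  rewrite -subr_ge0.
  have -> : r ^+ 3 * l * (8 * K) - (r + 1) * (K * (4 * r ^+ 2 * l))
    = 4 * K * r ^+ 2 * l * (r - 1) by ring.
  by rewrite !mulr_ge0 ?exprn_ge0 //; lra.
apply: (@form_eq0 _ _ B); apply/eqP; rewrite eq_le form_ge0 andbT leNgt; apply/negP => z_gt0.
have := step (Num.truncn (8 * K / '[z])); rewrite mulrC -ler_pdivlMr // leNgt.
by rewrite truncnS_gt.
Qed.

End PositiveContraction.

(** * The commutation theorem *)

Section Intertwining.
Context {R : realType} {V : lmodType R} (B : {dot V for idfun}).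
Local Notation "''[' u , v ]" := (B u v) : ring_scope.
Local Notation "''[' u ]" := (B u u) : ring_scope.
Variables (S A : {linear V -> V}) (A' : V -> V) (M : R) (l d : nat).
Hypothesis S_sym : forall x y, '[S x, y] = '[x, S y].
Hypothesis S_le1 : forall x, '[S x, x] <= '[x].
Hypothesis A_adj : forall x y, '[A x, y] = '[x, A' y].
Hypothesis M_gt0 : 0 < M.
Hypothesis A_normal : forall x, A' (A x) = M *: S x.
Hypothesis l_gt0 : (0 < l)%N.
Hypothesis d_gt0 : (0 < d)%N.
Hypothesis S_l : forall x, A' (iter l S (A x)) = M *: iter l.+1 S x.
Hypothesis S_k : forall x, A' (iter (l + d) S (A x)) = M *: iter (l + d).+1 S x.
Implicit Types (p q : {poly R}) (x y z w : V).

Lemma form_normA x : '[A x] = M * '[S x, x].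
Proof. by rewrite A_adj A_normal formZr S_sym. Qed.

Lemma contraction_ge0 x : 0 <= '[S x, x].
Proof. by rewrite -(pmulr_rge0 _ M_gt0) -form_normA form_ge0. Qed.

Lemma form_normA_le x : '[A x] <= M * '[x].
Proof. by rewrite form_normA ler_pM2l. Qed.

Let ge0 p x : cone p -> 0 <= '[pact S p x, x] := cone_pact_ge0 S_sym contraction_ge0 S_le1 x.

Let pact_le p q x : cone (q - p) -> '[pact S p x, x] <= '[pact S q x, x].
Proof. by move=> h; have := ge0 x h; rewrite pactB linearBl subr_ge0. Qed.

(** Since f = (X - a)^2 q with a^2 q(0) = d a^(l+d) and q >= q(0), the left side is at most a^2
    times the form of f(S) at [A x]. The power equalities turn the latter into M times the form of S
    f(S) at x, and X q <= q(1) finishes. *)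
Lemma resolvent_intertwining a x : 0 <= a <= 1 ->
  a ^+ (l + d) * '[S (A x) - a *: A x] <= M * (d * l * (l + d))%:R * '[S x - a *: x].
Proof.
move=> a01; have /andP[a0 a1] := a01.
have [q [fE q_ge0 q1_le]] := tangent_factor l d a01.
set f := (X in X = _) in fE.
have q00 : a ^+ 2 * q.[0] = d%:R * a ^+ (l + d).
  transitivity f.[0]; first by rewrite fE hornerM horner_exp hornerXsubC sub0r sqrrN.
  rewrite /f !(hornerE, hornerMn, hornerXn, horner_exp) !expr0n addn_eq0 (gtn_eqF l_gt0) /=.
  by rewrite !mulr0 subr0 add0r.
(* [good p] is the quadratic form of A' p(S) A = M S p(S). It is stable under linear combinations,
   so the monomials 1, X^l and X^(l+d) of f suffice. *)
pose good p := '[pact S p (A x), A x] = M * '[pact S ('X * p) x, x].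
have good_f : good f.
  have goodD p1 p2 : good p1 -> good p2 -> good (p1 + p2).
    by rewrite /good mulrDr !pactD !linearDl mulrDr /= => -> ->.
  have goodC c p : good p -> good (c%:P * p).
    by rewrite /good mulrCA !(pactM _ c%:P) !pactC !formZl mulrCA => ->.
  have goodXn n : A' (iter n S (A x)) = M *: iter n.+1 S x -> good 'X^n.
    by move=> h; rewrite /good pactXn formC A_adj h formZr formC pactM pactX pactXn.
  have -> : f = l%:R%:P * 'X^(l + d) + ((- ((l + d)%:R * a ^+ d))%:P * 'X^l
      + (d%:R * a ^+ (l + d))%:P * 'X^0).
    by rewrite /f polyCN !polyCM !polyC_exp !polyC_natr; ring.
  apply: (goodD); first exact: goodC (goodXn _ (S_k x)).
  by apply: goodD; apply: (goodC); apply: goodXn; [exact: S_l | exact: A_normal].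
have normE y : '[S y - a *: y] = '[pact S (('X - a%:P) ^+ 2) y, y].
  by rewrite -[_ ^+ 2]mulr1 form_pactM // pact1 pactXC.
apply: le_trans (_ : d%:R * a ^+ (l + d) * '[S (A x) - a *: A x] <= _).
  rewrite ler_wpM2r ?form_ge0 // ler_peMl ?exprn_ge0 //.
  by rewrite ler1n.
rewrite -q00 -mulrA; apply: le_trans (_ : a ^+ 2 * '[pact S f (A x), A x] <= _).
  rewrite ler_wpM2l ?sqr_ge0 // normE -formZl -(pactC S) -pactM; apply: pact_le.
  rewrite fE [_%:P * _]mulrC -mulrBr.
  by apply: coneM; [exact: cone_sqr | exact: cone_sub_horner0].
rewrite good_f; apply: le_trans (_ : M * '[pact S ('X * f) x, x] <= _).
  rewrite ler_piMl ?exprn_ile1 // mulr_ge0 ?(ltW M_gt0) // ge0 // fE mulrCA.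
  apply: coneM; [exact: cone_sqr | apply: cone_mulX; exact: cone_nneg].
rewrite -mulrA ler_pM2l // normE -formZl -(pactC S) -pactM; apply: pact_le.
have -> : (d * l * (l + d))%:R%:P * ('X - a%:P) ^+ 2 - 'X * f
  = ('X - a%:P) ^+ 2 * (((d * l * (l + d))%:R - q.[1])%:P + (q.[1]%:P - q) + (1 - 'X) * q).
  by rewrite fE polyCB; ring.
apply: coneM; first exact: cone_sqr.
apply: coneD; last by apply: cone_mul1X; exact: cone_nneg.
by apply: coneD; [apply: coneC; rewrite subr_ge0 | exact: cone_horner1_sub].
Qed.

Definition defect x := S (A x) - A (S x).

Lemma defect_is_linear : linear defect.
Proof. by move=> c x y; rewrite /defect !linearP /= scalerDr addrACA. Qed.

HB.instance Definition _ := GRing.isLinear.Build R V V _ defect defect_is_linear.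

(** Scalars commute with [A], so the defect equals (S - a) A - A (S - a) for every a; the first term
    is bounded by [resolvent_intertwining] and the second by the boundedness of [A]. *)
Lemma defect_bound : exists2 C, 0 <= C &
  forall a x, 0 <= a <= 1 -> a ^+ (l + d) * '[defect x] <= C * '[S x - a *: x].
Proof.
pose C1 := M * (d * l * (l + d))%:R.
have C1_ge0 : 0 <= C1 by rewrite mulr_ge0 // ltW.
exists (2 * C1 + 2 * M) => [|a x a01].
  by rewrite addr_ge0 // mulr_ge0 // ltW.
have ak : 0 <= a ^+ (l + d) <= 1 by case/andP: a01 => a0 a1; rewrite exprn_ge0 // exprn_ile1.
have -> : defect x = (S (A x) - a *: A x) + (- A (S x - a *: x)).
  by rewrite [A (_ - _)]linearB [A (_ *: _)]linearZ /= opprB addrA subrK.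
have := form_normD_le B (S (A x) - a *: A x) (- A (S x - a *: x)); rewrite hnormN.
have := resolvent_intertwining x a01; rewrite -/C1.
have := form_normA_le (S x - a *: x); have := form_ge0 B (A (S x - a *: x)).
set w := '[S (A x) - _]; set v := '[A _]; set t := '[S x - _]; set e := '[_ + _].
case/andP: ak; set c := a ^+ _ => c0 c1 v0 vt wt ewv.
have := ler_wpM2l c0 ewv; have : c * v <= v by rewrite ler_piMl.
lra.
Qed.

Lemma defect_expS_bound : exists2 C, 0 <= C &
  forall a x, 0 <= a <= 1 -> '[defect (iter (l + d) S x)] <= C * '[S x - a *: x].
Proof.
have [C C_ge0 hC] := defect_bound; set k := (l + d)%N in hC *.
exists (2 * C * k%:R ^+ 2 + 2 * C) => [|a x a01].
  by rewrite addr_ge0 // ?mulr_ge0 // exprn_ge0.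
have /andP[a0 a1] := a01.
have normE p y : '[pact S p y] = '[pact S (p ^+ 2) y, y].
  by rewrite -[_ ^+ 2]mulr1 form_pactM // pact1.
(* The case a = 1 of the previous bound shows that the defect is a bounded operator, because 0 <= 1
   - S <= 1. *)
have hC1 y : '[defect y] <= C * '[y].
  have := hC 1 y; rewrite expr1n mul1r scale1r ler01 lexx => /(_ isT)/le_trans; apply.
  apply: ler_wpM2l => //.
  have -> : S y - y = pact S (1 - 'X) (- y).
    by rewrite pactB pact1 pactX linearN /= opprK addrC.
  rewrite normE -(hnormN _ y); have := @pact_le ((1 - 'X) ^+ 2) 1 (- y); rewrite pact1; apply.
  have -> : 1 - (1 - 'X) ^+ 2 = 'X * (1 + (1 - 'X)) :> {poly R} by ring.
  by apply: cone_mulX; apply: coneD; [exact: cone1 | exact: cone1X].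
(* h is the quotient of X^k - a^k by X - a; its k terms lie between 0 and 1, whence h(S)^2 <=
   k^2. *)
pose h : {poly R} := \sum_(m < k) 'X^(k.-1 - m) * a%:P ^+ m.
have h_ge0 : nneg_coef h by exact: nneg_geom.
have hk : '[iter k S x - a ^+ k *: x] <= k%:R ^+ 2 * '[S x - a *: x].
  rewrite -pactXn -[a ^+ k *: x](pactC S) -pactB polyC_exp subrXX mulrC pactM pactXC -/h.
  rewrite normE -formZl -[_ ^+ 2 *: _](pactC S); apply: pact_le; rewrite polyC_exp subr_sqr.
  have ch : cone (k%:R%:P - h).
    rewrite -[_%:P](subrK h.[1]%:P) -addrA -polyCB; apply: coneD; last exact: cone_horner1_sub.
    by apply: coneC; rewrite subr_ge0 horner1_geom_le.
  by apply: coneM => //; apply: coneD; [apply: coneC; rewrite ler0n | exact: cone_nneg].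
have -> : iter k S x = (iter k S x - a ^+ k *: x) + a ^+ k *: x by rewrite subrK.
rewrite [defect _]linearD /= [defect (_ *: _)]linearZ /=.
apply: le_trans (form_normD_le B _ _) _.
rewrite [leRHS]mulrDl; apply: lerD.
  rewrite -[2 * C * _]mulrA -[leRHS]mulrA ler_wpM2l //; apply: le_trans (hC1 _) _.
  by rewrite -mulrA ler_wpM2l.
(* The part a^k x contributes a^(2k), and one factor a^k is dropped as it is at most 1. *)
rewrite -mulrA ler_wpM2l // formZl formZr; apply: le_trans (hC a x a01).
by rewrite ler_wpM2l ?exprn_ge0 // ler_piMl ?form_ge0 ?exprn_ile1.
Qed.

(** By symmetry |S^(n+1) w|^2 is the product of S^n w with S^(n+2) w, so the kernel of a power does
    not exceed that of [S]. *)
Lemma iter_sym_eq0 n w : iter n.+1 S w = 0 -> S w = 0.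
Proof.
elim: n => // n IH h; apply: IH; apply: (@form_eq0 _ _ B).
by rewrite {1}iterS S_sym -iterS h linear0r.
Qed.

Lemma intertwining x : S (A x) = A (S x).
Proof.
have [C C_ge0 hC] := defect_expS_bound.
have defectE x1 y : '[defect x1, y] = '[x1, A' (S y) - S (A' y)].
  by rewrite /defect linearBl linearBr /= S_sym !A_adj S_sym.
suff h y : A' (S y) - S (A' y) = 0.
  apply/eqP; rewrite -subr_eq0; apply/eqP/(@form_eq0 _ _ B).
  by rewrite -/(defect x) defectE h linear0r.
(* w is the adjoint of the defect applied to y. *)
set w := _ - _.
have iterS_sym n x1 y1 : '[iter n S x1, y1] = '[x1, iter n S y1].
  by elim: n y1 => //= n IH y1; rewrite S_sym IH -iterSr.
have kw : iter (l + d) S w = 0.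
  apply: (@eq0_of_resolvent_bound _ _ B S S_sym contraction_ge0 S_le1 (C * '[y])).
    by rewrite mulr_ge0 ?form_ge0.
  move=> a x1 a01; rewrite -iterS_sym -defectE.
  apply: le_trans (form_CauchySchwarz _ _ _) _.
  by rewrite mulrAC ler_wpM2r ?form_ge0 ?hC.
have Sw : S w = 0 by move: kw; rewrite -(prednK l_gt0) addSn => /iter_sym_eq0.
have Aw : A w = 0 by apply: (@form_eq0 _ _ B); rewrite form_normA Sw linear0l mulr0.
(* Expanding one copy of w in its squared norm, A' (S y) is orthogonal to w because A w = 0, and S
   (A' y) because S w = 0. *)
apply: (@form_eq0 _ _ B); rewrite {2}/w linearBr /= -A_adj Aw linear0l -S_sym Sw linear0l.
exact: subrr.
Qed.

End Intertwining.

(** * The real Hilbert space underlying a complex one *)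

Section Riesz.
Context {R : realType} {V : lmodType R} (B : {dot V for idfun}).
Local Notation "''[' u , v ]" := (B u v) : ring_scope.
Local Notation "''[' u ]" := (B u u) : ring_scope.
Hypothesis complete : forall u : nat -> V,
  (forall e, 0 < e -> exists N, forall m n, (N <= m)%N -> (N <= n)%N -> '[u m - u n] < e) ->
  exists z, forall e, 0 < e -> exists N, forall n, (N <= n)%N -> '[u n - z] < e.

(* The representative is the minimiser of ['[x] - 2 * f x]. *)
Lemma riesz (f : {scalar V}) C : 0 <= C -> (forall x, f x ^+ 2 <= C * '[x]) ->
  exists z, forall x, f x = '[x, z].
Proof.
move=> C0 fC; pose J x := '[x] - 2 * f x.
(* 2 |f x| <= 2 sqrt(C '[x]) <= '[x] + C. *)
have J_lb x : - C <= J x.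
  have := fC x; have := form_ge0 B x; rewrite /J; move: '[x] (f x) => n g n0 h.
  rewrite -subr_ge0 leNgt; apply/negP => hlt.
  have : (n + C) ^+ 2 < (2 * g) ^+ 2 by rewrite ltr_pXn2r ?nnegrE //; lra.
  by have := sqr_ge0 (n - C); nra.
pose E := [set J x | x in [set: V]]%classic.
have infE : has_inf E by split; [exists (J 0), 0 | exists (- C) => _ [x _ <-]].
pose m := inf E.
have m_le x : m <= J x by apply: ge_inf; [exact: infE.2 | exists x].
have eps_gt0 n : 0 < n.+1%:R^-1 :> R by rewrite invr_gt0 ltr0n.
have /choice[u uJ] n : exists x, J x < m + n.+1%:R^-1.
  by have [_ [x _ <-] h] := inf_adherent (eps_gt0 n) infE; exists x.
have eps_small e : 0 < e -> exists N, forall n, (N <= n)%N -> n.+1%:R^-1 < e :> R.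
  move=> e0; exists (Num.truncn e^-1) => n Nn.
  rewrite invf_plt ?posrE ?ltr0n //; apply: lt_le_trans (truncnS_gt _) _.
  by rewrite ler_nat ltnS.
have JD x y : J (x + y) = J x + '[y] + 2 * ('[x, y] - f y).
  by rewrite /J form_normD linearD /=; ring.
have [z uz] : exists z, forall e, 0 < e -> exists N, forall n, (N <= n)%N -> '[u n - z] < e.
  apply: complete => e e0; have [N hN] := eps_small (e / 4) (divr_gt0 e0 (ltr0n _ 4)).
  (* The parallelogram law compares J at the midpoint, which is at least m, with its values at u a
     and u b, so a minimising sequence is Cauchy. *)
  exists N => a b Na Nb.
  have Jmid : 4 * J (2^-1 *: (u a + u b)) + '[u a - u b] = 2 * J (u a) + 2 * J (u b).
    rewrite /J [f (_ *: _)]linearZ /= [f (_ + _)]linearD /=.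
    by rewrite formZl formZr form_normD form_normB; field.
  have := m_le (2^-1 *: (u a + u b)); have := uJ a; have := uJ b.
  have := hN _ Na; have := hN _ Nb; move: Jmid.
  by move: b.+1%:R^-1 a.+1%:R^-1 '[_] (J _) (J _) (J _) => ib ia n j1 j2 j3; lra.
exists z => x0.
(* This says J (z + x) >= J z. Testing it on a suitable multiple of x0 kills the linear term; the
   [+ 1] in the denominator covers x0 = 0. *)
suff pos x : 0 <= '[x] + 2 * ('[z, x] - f x).
  have := pos (- ('[z, x0] - f x0) / ('[x0] + 1) *: x0).
  have := form_ge0 B x0.
  rewrite formZl formZr formZr linearZ /= (formC B x0 z).
  move: '[x0] '[z, x0] (f x0) => n g h n0.
  have n1 : n + 1 != 0 by rewrite gt_eqF //; lra.
  have -> : - (g - h) / (n + 1) * (- (g - h) / (n + 1) * n)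
     + 2 * (- (g - h) / (n + 1) * g - - (g - h) / (n + 1) * h)
     = - ((g - h) / (n + 1)) ^+ 2 * (n + 2) by field.
  rewrite mulNr oppr_ge0 => le0; apply/esym/eqP; rewrite -subr_eq0.
  have : ((g - h) / (n + 1)) ^+ 2 == 0.
    rewrite eq_le sqr_ge0 andbT -(pmulr_lle0 _ (_ : 0 < n + 2)) //; lra.
  by rewrite sqrf_eq0 mulf_eq0 invr_eq0 (negbTE n1) orbF.
(* If Q < 0, then J (u n + x) would drop below the infimum for large n. Half of -Q absorbs the error
   of J (u n); the other half absorbs 2 '[u n - z, x], which through Cauchy-Schwarz gives the
   threshold Q^2 / 16. *)
rewrite leNgt; apply/negP; set Q := _ + _ => Q0.
have x1 : 0 < '[x] + 1 by have := form_ge0 B x; lra.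
have [N1 hN1] := eps_small (- Q / 2) ltac:(lra).
have e0 : 0 < Q ^+ 2 / 16 / ('[x] + 1).
  by rewrite divr_gt0 // divr_gt0 // exprn_even_gt0 //= lt_eqF.
have [N2 hN2] := uz _ e0; pose n := maxn N1 N2.
have := hN1 n (leq_maxl _ _); have := hN2 n (leq_maxr _ _).
have := m_le (u n + x); have := uJ n; rewrite JD; set ep := _^-1.
rewrite ltr_pdivlMr // => h1 h2 h3 h4.
have h5 : - Q / 2 < 2 * '[u n - z, x].
  by rewrite linearBl /=; move: h1 h2 h4; rewrite /Q; lra.
have h6 : (- Q / 4) ^+ 2 < '[u n - z, x] ^+ 2 by rewrite ltr_pXn2r ?nnegrE //; lra.
have := form_CauchySchwarz B (u n - z) x.
have := form_ge0 B (u n - z); move: '[u n - z] '[u n - z, x] h3 h6 => a b; nra.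
Qed.

End Riesz.

(** A second name for [H], so that the real scalar action does not clash with the complex one. *)
Definition realify (R : realType) (H : hilbertType R) : Type := H.

Section Realify.
Context {R : realType} {H : hilbertType R}.
Local Open Scope complex_scope.

HB.instance Definition _ := GRing.Zmodule.copy (realify H) H.

Definition real_scale (c : R) (x : realify H) : realify H := c%:C *: (x : H).

Lemma real_scaleA a b x : real_scale a (real_scale b x) = real_scale (a * b) x.
Proof. by rewrite /real_scale scalerA rmorphM. Qed.

Lemma real_scale1 : left_id 1 real_scale.
Proof. by move=> x; rewrite /real_scale scale1r. Qed.

Lemma real_scaleDr : right_distributive real_scale +%R.
Proof. by move=> c x y; rewrite /real_scale scalerDr. Qed.

Lemma real_scaleDl x : {morph real_scale^~ x : a b / a + b}.
Proof. by move=> a b; rewrite /real_scale rmorphD /= scalerDl. Qed.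

HB.instance Definition _ := GRing.Zmodule_isLmodule.Build R (realify H)
  real_scaleA real_scale1 real_scaleDr real_scaleDl.

Definition real_inner (x y : realify H) : R := complex.Re (inner (x : H) (y : H)).

Lemma ReD (a b : R[i]) : complex.Re (a + b) = complex.Re a + complex.Re b.
Proof. exact: raddfD. Qed.

Lemma ReZ (c : R) (a : R[i]) : complex.Re (c%:C * a) = c * complex.Re a.
Proof. by case: a => a b /=; rewrite mul0r subr0. Qed.

Lemma conjE (a : R[i]) : Num.conj a = a^*.
Proof. by []. Qed.

Lemma real_inner_bilinear :
  bilinear_for (GRing.Scale.Law.clone _ _ *%R _)
    (GRing.Scale.Law.clone _ _ (idfun \; *%R) _) real_inner.
Proof.
split=> z c x y; rewrite /real_inner /=.
  by rewrite linearDl linearZl_LR ReD ReZ.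
by rewrite linearDr linearZr_LR /= conjE conjc_real ReD ReZ.
Qed.

HB.instance Definition _ := bilinear_isBilinear.Build R (realify H) (realify H) R
  _ _ real_inner real_inner_bilinear.

Lemma real_inner_sym (x y : realify H) :
  real_inner x y = (-1) ^+ false * idfun (real_inner y x).
Proof. by rewrite /real_inner hermC expr0 !mul1r /= conjE; case: (inner _ _). Qed.

HB.instance Definition _ := isHermitianSesquilinear.Build R (realify H)
  false idfun real_inner real_inner_sym.

Lemma real_inner_norm (x : realify H) : (real_inner x x)%:C = `|x : H| ^+ 2.
Proof.
rewrite -inner_norm /real_inner RRe_real // inner_norm.
by rewrite realX // normr_real.
Qed.

Lemma real_inner_gt0 (x : realify H) : x != 0 -> 0 < real_inner x x.
Proof. by move=> x0; rewrite -ltcR real_inner_norm exprn_gt0 // normr_gt0. Qed.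

HB.instance Definition _ := isDotProduct.Build R (realify H) real_inner real_inner_gt0.

Definition real_dot : {dot realify H for idfun} := real_inner.

Lemma norm_lt_real_dot (x : H) (e : R) : 0 < e ->
  (`|x| < e%:C) = (real_dot x x < e ^+ 2).
Proof.
move=> e0; rewrite -ltcR real_inner_norm rmorphXn /= ltr_pXn2r // nnegrE //.
by rewrite ler0c ltW.
Qed.

Lemma realify_complete (u : nat -> realify H) :
  (forall e, 0 < e -> exists N, forall m n, (N <= m)%N -> (N <= n)%N ->
     real_dot (u m - u n) (u m - u n) < e) ->
  exists z, forall e, 0 < e -> exists N, forall n, (N <= n)%N ->
     real_dot (u n - z) (u n - z) < e.
Proof.
move=> cu; pose v : nat -> H := u.
(* The norm of [H] takes values in R[i], where a positive element is necessarily real. *)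
have gt0E (e : R[i]) : 0 < e -> exists2 r : R, 0 < r & e = r%:C.
  case: e => a b; rewrite ltcE /= => /andP[/eqP -> a0].
  by exists a.
have cvg_v : cvg (v @ \oo)%classic.
  apply/cauchy_cvgP/cauchy_ballP => e /gt0E[r r0 ->].
  have [N hN] := cu (r ^+ 2) (exprn_gt0 _ r0).
  rewrite near_map2; exists ([set n | (N <= n)%N], [set n | (N <= n)%N])%classic.
    by split; exists N.
  move=> [m n] [/= Nm Nn]; rewrite -ball_normE /= norm_lt_real_dot //.
  exact: hN.
exists (lim (v @ \oo)%classic) => e e0.
have r0 : 0 < Num.sqrt e by rewrite sqrtr_gt0.
have /cvgrPdist_lt /(_ (Num.sqrt e)%:C) := cvg_v.
rewrite ltcR => /(_ r0)[N _ hN]; exists N => n Nn.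
have /= := hN n Nn; rewrite distrC norm_lt_real_dot // sqr_sqrtr //.
exact: ltW.
Qed.

End Realify.

(** * Existence of the adjoint, and quasinormality from the power equalities *)

Section Adjoint.
Context {R : realType} {H : hilbertType R} (A : {linear H -> H}).
Hypothesis A_bounded : bounded_operator A.
Local Open Scope complex_scope.
Local Notation "''[' u , v ]" := (@real_dot R H u v) : ring_scope.
Local Notation "''[' u ]" := (@real_dot R H u u) : ring_scope.

Definition real_op (x : realify H) : realify H := A x.

Lemma real_op_is_linear : linear real_op.
Proof. by move=> c x y; exact: (linearP A). Qed.

HB.instance Definition _ := GRing.isLinear.Build R (realify H) (realify H) _
  real_op real_op_is_linear.

Lemma real_op_bounded : exists2 M, 0 < M & forall x, '[real_op x] <= M * '[x].
Proof.
(* The [+ 1] makes the constant invertible, as it later serves to normalise A' A. *)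
have [M hM] := A_bounded; exists (M ^+ 2 + 1) => [|x].
  by rewrite ltr_wpDl // sqr_ge0.
apply: (@le_trans _ _ (M ^+ 2 * '[x])); last by rewrite ler_wpM2r ?form_ge0 // lerDl.
rewrite -lecR rmorphM rmorphXn /= !real_inner_norm -exprMn.
by rewrite lerXn2r // nnegrE // (le_trans _ (hM x)).
Qed.

Lemma adjointP (x y : H) : inner (A x) y = inner x (adjoint A y).
Proof.
suff : exists z, forall x : H, inner (A x) y = inner x z.
  by move=> /(@xgetPex _ 0); apply.
have f_scalar : scalar (fun x : realify H => '[real_op x, y]).
  by move=> c u v; rewrite [real_op _]linearP linearDl /= formZl.
pose f : {scalar realify H} := HB.pack (fun x : realify H => '[real_op x, y])
  (GRing.isLinear.Build R (realify H) R _ _ f_scalar).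
have [M M0 hM] := real_op_bounded.
have [||z hz] := @riesz R (realify H) real_dot (@realify_complete R H) f (M * '[y]).
- by rewrite mulr_ge0 ?form_ge0 // ltW.
- move=> u; apply: le_trans (form_CauchySchwarz _ _ _) _.
  by rewrite mulrAC ler_wpM2r ?form_ge0.
(* The real Riesz vector matches the real parts; replacing x by i x matches the imaginary parts. *)
exists z => {}x; have h u : complex.Re (inner (A u) y) = complex.Re (inner u (z : H)) := hz u.
apply/eqP; rewrite eq_complex h eqxx /=.
have := h ('i%C *: x); rewrite linearZ /= !linearZl_LR.
by rewrite ![_ * inner _ _]mulrC !ReiNIm => /oppr_inj ->.
Qed.

Definition real_adjoint (x : realify H) : realify H := adjoint A x.

Lemma real_adjointP x y : '[real_op x, y] = '[x, real_adjoint y].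
Proof. by congr complex.Re; exact: adjointP. Qed.

Lemma real_adjoint_is_linear : linear real_adjoint.
Proof.
move=> c x y; apply: (@form_ext _ _ real_dot) => z.
rewrite -real_adjointP [LHS]linearDr [RHS]linearDr /= !formZr.
by rewrite -!real_adjointP.
Qed.

HB.instance Definition _ := GRing.isLinear.Build R (realify H) (realify H) _
  real_adjoint real_adjoint_is_linear.

Lemma quasinormal_of_power_equalities k l : (0 < l)%N -> (l < k)%N ->
  (forall s : nat, s \in [:: l; l.+1; k; k.+1] ->
     iter s (adjoint A) \o iter s A = iter s (adjoint A \o A)) ->
  quasinormal A.
Proof.
move=> l_gt0 lt_lk hs; have [M M_gt0 hM] := real_op_bounded.
have M0 : M != 0 by rewrite gt_eqF.
pose T : {linear realify H -> realify H} := real_adjoint \o real_op.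
pose S : {linear realify H -> realify H} := M^-1 \*: T.
have TE x : T x = M *: S x by rewrite /S /= scalerA mulfV // scale1r.
have T_form x y : '[T x, y] = '[real_op x, real_op y].
  by rewrite formC -real_adjointP formC.
have iterT n x : iter n S x = M ^- n *: iter n T x.
  elim: n => [|n IH]; first by rewrite expr0 invr1 scale1r.
  by rewrite iterS IH /S /= linearZ /= linearZ /= scalerA exprS invfM.
(* The equality for n + 1, with the one for n substituted between the outermost adjoint and the
   innermost [A], gives A' T^n A = T^(n+1). *)
have power n x : n \in [:: l; k] -> real_adjoint (iter n T (real_op x)) = iter n.+1 T x.
  move=> hn.
  have hn0 : n \in [:: l; l.+1; k; k.+1].
    by move: hn; rewrite !inE => /orP[] ->; rewrite ?orbT.
  have hn1 : n.+1 \in [:: l; l.+1; k; k.+1].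
    by move: hn; rewrite !inE => /orP[] /eqP ->; rewrite eqxx ?orbT.
  have h0 : iter n (adjoint A) (iter n A (A x)) = iter n (adjoint A \o A) (A x).
    by have := congr1 (fun f => f (A x)) (hs _ hn0).
  have h1 : adjoint A (iter n (adjoint A) (iter n A (A x))) = iter n.+1 (adjoint A \o A) x.
    by rewrite -iterSr; have := congr1 (fun f => f (x : H)) (hs _ hn1).
  by rewrite -[RHS]h1 h0.
have powerS n x : n \in [:: l; k] -> real_adjoint (iter n S (real_op x)) = M *: iter n.+1 S x.
  by move=> hn; rewrite !iterT linearZ /= power // scalerA exprS invfM mulVKf.
have d_gt0 : (0 < k - l)%N by rewrite subn_gt0.
have kE : (l + (k - l) = k)%N by rewrite subnKC // ltnW.
have := @intertwining R (realify H) real_dot S real_op real_adjoint M l (k - l).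
rewrite kE => /(_ _ _ _ _ _ l_gt0 d_gt0) comm.
apply/funext => x.
suff : T (real_op x) = real_op (T x) by [].
rewrite !TE; have -> : real_op (M *: S x) = M *: real_op (S x) by exact: linearZ.
rewrite comm //.
- by move=> u v; rewrite formZl formZr T_form [in RHS]formC T_form formC.
- by move=> u; rewrite formZl T_form ler_pdivrMl.
- exact: real_adjointP.
- by move=> u; apply: powerS; rewrite !inE eqxx.
- by move=> u; apply: powerS; rewrite !inE eqxx orbT.
Qed.

End Adjoint.

(** Writing T for [adjoint A \o A], which commutes with [A], the induction step replaces the inner s
    adjoints and s copies of [A] by T^s, then moves T^s to the right of the remaining [A]. *)
Lemma power_equality_of_quasinormal (R : realType) (H : hilbertType R)
    (A : {linear H -> H}) s : quasinormal A ->
  iter s (adjoint A) \o iter s A = iter s (adjoint A \o A).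
Proof.
move=> qA; have commT n x : iter n (adjoint A \o A) (A x) = A (iter n (adjoint A \o A) x).
  by elim: n => //= n ->; rewrite -[LHS](congr1 (fun f => f _) qA).
elim: s => // s IH; apply/funext => x.
have /= IHAx := congr1 (fun f => f (A x)) IH.
by rewrite -[A (iter s A x)]iterS iterSr IHAx commT.
Qed.

Theorem theorem3p2 (R : realType) (H : hilbertType R) (A : {linear H -> H})
    (hA : bounded_operator A) (k l : nat) (l_gt0 : (0 < l)%N)
    (lt_lk : (l < k)%N) :
  quasinormal A <->
  (forall s : nat, s \in [:: l; l.+1; k; k.+1] ->
     iter s (adjoint A) \o iter s A = iter s (adjoint A \o A)).
Proof.
split=> [qA s _|]; first exact: power_equality_of_quasinormal.
exact (@quasinormal_of_power_equalities R H A hA k l l_gt0 lt_lk).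
Qed.
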